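(* For every problem instance with identical resources (that is, $d_1=d_2=\dots=d_m$) we have $$\max_{N\in\mathcal{N}} C(N)\;\le\; 3\,\min_{N\in\mathcal{N}} C(N),$$ where $\mathcal{N}$ is the set of all Nash assignments of the instance.
   Context: A problem instance $(T,R)$ consists of a set $R=\{1,\dots,m\}$ of resources with delays (positive reals) $d_1\le\dots\le d_m$ and a set $T=\{1,\dots,n\}$ of tasks with real weights $w_1,\dots,w_n\ge 1$. An assignment is a vector $A=(A_1,\dots,A_n)\in\{1,\dots,m\}^n$ (task $i$ is assigned to resource $A_i$). The load of resource $\ell$ in $A$ is $L(\ell,A)=d_\ell\sum_{i\in T:\,A_i=\ell}w_i$, the load of task $i$ is $L(A_i,A)$, and the social cost is $C(A)=\sum_{i\in T}L(A_i,A)$. An assignment $A$ is a Nash assignment if for every task $i$ and every resource $\ell$ we have $L(A_i,A)\le L(\ell,A')$, where $A'$ is obtained from $A$ by re-assigning task $i$ to resource $\ell$ and making no other change. $\mathcal{N}=\mathcal{N}(T,R)$ is the set of all Nash assignments; it is known to be nonempty. *)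

(* Defs.v *)
From HB Require Import structures.
From mathcomp Require Import all_boot all_order all_algebra.
From mathcomp Require Import reals.
From mathcomp Require Import ring lra.

Set Implicit Arguments.
Unset Strict Implicit.
Unset Printing Implicit Defensive.

Import Order.TTheory GRing.Theory Num.Theory.
Local Open Scope ring_scope.

(* Tasks and resources are numbered from 0: task i is an element of 'I_n and
   resource l an element of 'I_m.  The empty task set (n = 0) is allowed. *)
Record instance (R : realType) := Instance {
  nres : nat;
  ntask : nat;
  delay : 'I_nres -> R;
  weight : 'I_ntask -> R;
  nres_gt0 : (0 < nres)%N;
  delay_gt0 : forall l, 0 < delay l;
  delay_sorted : forall k l : 'I_nres, (k <= l)%N -> delay k <= delay l;
  weight_ge1 : forall i, 1 <= weight i
}.

Definition identical_resources (R : realType) (I : instance R) : Prop :=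
  forall k l : 'I_(nres I), delay k = delay l.

Definition assignment (R : realType) (I : instance R) : finType :=
  {ffun 'I_(ntask I) -> 'I_(nres I)}.

Definition load (R : realType) (I : instance R) (l : 'I_(nres I))
    (A : assignment I) : R :=
  delay l * \sum_(i < ntask I | A i == l) weight i.

Definition social_cost (R : realType) (I : instance R) (A : assignment I) : R :=
  \sum_(i < ntask I) load (A i) A.

Definition reassign (R : realType) (I : instance R) (A : assignment I)
    (i : 'I_(ntask I)) (l : 'I_(nres I)) : assignment I :=
  [ffun j => if j == i then l else A j].

Definition nash (R : realType) (I : instance R) : pred (assignment I) :=
  fun A => [forall i, forall l, load (A i) A <= load l (reassign A i l)].

(* A Nash assignment exists: any minimizer of the potential
   \sum_l d_l ((\sum_(A i = l) w_i)^2 + \sum_(A i = l) w_i^2) is one. *)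
Section NashExists.
Variables (R : realType) (I : instance R).
Implicit Type A : assignment I.

Let W A l := \sum_(i < ntask I | A i == l) weight i.
Let Q A l := \sum_(i < ntask I | A i == l) weight i ^+ 2.
Let potential A := \sum_(l < nres I) delay l * (W A l ^+ 2 + Q A l).

Let sum_move (F : 'I_(ntask I) -> R) A i l k :
  l != A i ->
  \sum_(j | reassign A i l j == k) F j =
  \sum_(j | A j == k) F j + (if k == l then F i else 0)
                          - (if k == A i then F i else 0).
Proof.
move=> li.
rewrite !(big_mkcond (fun j => _ == k)) /= (bigD1 i) //= [in RHS](bigD1 i) //=.
rewrite ffunE eqxx.
under eq_bigr => j ji do rewrite ffunE (negbTE ji).
rewrite [l == k]eq_sym [A i == k]eq_sym.
by case: (k == l); case: (k == A i); ring.
Qed.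

Lemma nash_exists : exists A, nash A.
Proof.
pose A0 : assignment I := [ffun=> Ordinal (nres_gt0 I)].
case: (@arg_minP _ R _ A0 predT potential isT) => A _ minA.
exists A; apply/forallP => i; apply/forallP => l.
have [->|li] := eqVneq l (A i).
  suff -> : reassign A i (A i) = A by [].
  by apply/ffunP => j; rewrite ffunE; case: eqP => [->|].
have := minA (reassign A i l) isT.
rewrite /potential (bigD1 (A i)) //= (bigD1 l) //=.
rewrite [X in _ <= X](bigD1 (A i)) //= [X in _ <= _ + X](bigD1 l) //=.
rewrite [X in _ <= _ + (_ + X)](eq_bigr
  (fun k => delay k * (W A k ^+ 2 + Q A k))); last first.
  by move=> k /andP[/negbTE ki /negbTE kl];
     rewrite /W /Q !sum_move // ki kl !addr0 !subr0.
rewrite /load !(sum_move (@weight R I)) // /W /Q !sum_move //.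
rewrite !eqxx (negbTE li) (eq_sym (A i)) (negbTE li).
set S := \sum_(_ | _) delay _ * _.
set a := \sum_(_ | _) weight _; set b := \sum_(_ | _) weight _.
set qa := \sum_(_ | _) weight _ ^+ 2; set qb := \sum_(_ | _) weight _ ^+ 2.
have w0 : 0 < weight i by apply: lt_le_trans (weight_ge1 i).
move=> h; rewrite -(ler_pM2l w0); lra.
Qed.

End NashExists.

Definition some_nash (R : realType) (I : instance R) : assignment I :=
  xchoose (nash_exists I).

(* some_nash only witnesses that the finite range of N is nonempty; the values
   below do not depend on it, see max_nash_costP and min_nash_costP. *)
Definition max_nash_cost (R : realType) (I : instance R) : R :=
  social_cost [arg max_(N > some_nash I | nash N) social_cost N]%O.

Definition min_nash_cost (R : realType) (I : instance R) : R :=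
  social_cost [arg min_(N < some_nash I | nash N) social_cost N]%O.

Lemma max_nash_costP (R : realType) (I : instance R) :
  (exists2 N : assignment I, nash N & max_nash_cost I = social_cost N) /\
  (forall N : assignment I, nash N -> social_cost N <= max_nash_cost I).
Proof.
rewrite /max_nash_cost; case: arg_maxP; first exact: xchooseP.
by move=> A nA mA; split => //; exists A.
Qed.

Lemma min_nash_costP (R : realType) (I : instance R) :
  (exists2 N : assignment I, nash N & min_nash_cost I = social_cost N) /\
  (forall N : assignment I, nash N -> min_nash_cost I <= social_cost N).
Proof.
rewrite /min_nash_cost; case: arg_minP; first exact: xchooseP.
by move=> A nA mA; split => //; exists A.
Qed.

(* Main.v *)
Require Import Defs.
From mathcomp Require Import all_boot all_order all_algebra.
From mathcomp Require Import reals.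
From mathcomp Require Import lra.

Import Order.TTheory GRing.Theory Num.Theory.
Local Open Scope ring_scope.

(** Divide all loads by the common delay, and let [a], [b] be the least loads
    of two Nash assignments [A], [B].  A task of weight [w] has load at most
    [a + w] in [A], so [C(A) <= W + n a], where [W] is the total weight, while
    [C(B) >= W] and [C(B) >= n b].  It remains to see that [a <= 2 b].  In [B] a
    resource of load more than [2 b] carries a single task, since each of its
    tasks weighs more than half its load.  If there are [k < m] such tasks, the
    others have total weight at most [(m - k) 2 b]; in [A] at least [m - k]
    resources carry only these others, so their weight is at least
    [(m - k) a]. *)

Section NashLoads.
Variables (R : realType) (I : instance R).
Implicit Types (A B : assignment I) (l : 'I_(nres I)) (i : 'I_(ntask I)).

Definition load_weight l A : R := \sum_(i < ntask I | A i == l) weight i.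

Lemma weight_gt0 i : 0 < weight i.
Proof. exact: lt_le_trans ltr01 (weight_ge1 i). Qed.

Lemma load_weight_ge0 l A : 0 <= load_weight l A.
Proof. by apply: sumr_ge0 => i _; apply/ltW/weight_gt0. Qed.

Lemma weight_le_load_weight i A : weight i <= load_weight (A i) A.
Proof.
rewrite /load_weight (bigD1 i) //= lerDl.
by apply: sumr_ge0 => j _; apply/ltW/weight_gt0.
Qed.

Lemma sum_load_weight (P : pred 'I_(nres I)) A :
  \sum_(l | P l) load_weight l A = \sum_(i | P (A i)) weight i.
Proof.
rewrite (partition_big (fun i => A i) P) //=; apply: eq_bigr => l Pl.
by apply: eq_bigl => i; case: eqP => [->|]; rewrite ?Pl ?andbF.
Qed.

(** Equality can fail: if [i] already sits on [l], the move adds nothing. *)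
Lemma load_weight_reassign A i l :
  load_weight l (reassign A i l) <= load_weight l A + weight i.
Proof.
rewrite /load_weight (bigD1 i) ?ffunE ?eqxx //= addrC lerD2r.
rewrite big_mkcond [leRHS]big_mkcond; apply: ler_sum => j _.
rewrite ffunE; case: (j == i); rewrite ?andbF ?andbT //.
by case: (A j == l) => //; apply/ltW/weight_gt0.
Qed.

Definition least_load A l0 := forall l, load_weight l0 A <= load_weight l A.

Lemma exists_least_load A : exists l0, least_load A l0.
Proof.
case: (@arg_minP _ R _ (Ordinal (nres_gt0 I)) predT (load_weight^~ A) isT).
by move=> l0 _ min_l0; exists l0 => l; apply: min_l0.
Qed.

Hypothesis identI : identical_resources I.

Lemma nash_load_weight A i l : nash A ->
  load_weight (A i) A <= load_weight l A + weight i.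
Proof.
move=> /forallP/(_ i)/forallP/(_ l).
rewrite /load (identI (A i) l) ler_pM2l ?delay_gt0 // => le_load.
exact: le_trans le_load (load_weight_reassign _ _ _).
Qed.

(** If distinct [i], [j] shared a resource of load [L], adding their Nash inequalities against [l0]
    would give [2 L <= 2 load_weight l0 B + weight i + weight j], where the two weights sum to at
    most [L]. *)
Lemma nash_heavy_load_inj B l0 i j : nash B ->
  2 * load_weight l0 B < load_weight (B i) B -> B i = B j -> i = j.
Proof.
move=> nashB heavy eq_Bij; apply/eqP; apply: contraTT heavy => neq_ij.
have le_i := nash_load_weight B i l0 nashB.
have le_j := nash_load_weight B j l0 nashB.
rewrite -eq_Bij in le_j.
have : weight i + weight j <= load_weight (B i) B.
  rewrite /load_weight (bigD1 i) //= (bigD1 j) /=; last first.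
    by rewrite -eq_Bij eqxx eq_sym.
  rewrite lerD2l lerDl.
  by apply: sumr_ge0 => k _; apply/ltW/weight_gt0.
by rewrite -leNgt; lra.
Qed.

Lemma nash_least_load_le2 A B a0 b0 : nash B ->
  least_load A a0 -> load_weight a0 A <= 2 * load_weight b0 B.
Proof.
move=> nashB min_a0.
pose a := load_weight a0 A; pose b := load_weight b0 B.
have b_ge0 : 0 <= b by apply: load_weight_ge0.
pose heavy := [set l | 2 * b < load_weight l B].
pose heavy_tasks := [set i | B i \in heavy].
pose hosts := [set A i | i in heavy_tasks].
have card_tasks : (#|heavy_tasks| <= #|heavy|)%N.
  rewrite -(@card_in_imset _ _ (fun i => B i) heavy_tasks); last first.
    by move=> i j; rewrite !inE => + _; apply: nash_heavy_load_inj.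
  by apply/subset_leq_card/subsetP => _ /imsetP[i + ->]; rewrite inE.
(* [A] may put several heavy tasks on one resource, so [hosts] has at most as many elements as
   [heavy]. *)
have card_hosts : (#|~: heavy| <= #|~: hosts|)%N.
  rewrite -(leq_add2l #|heavy|) cardsC -(cardsC hosts) leq_add2r.
  exact: leq_trans (leq_imset_card _ _) card_tasks.
(* The resource [b0] itself is light, as [b <= 2 * b]. *)
have light_gt0 : 0 < #|~: heavy|%:R :> R.
  rewrite ltr0n card_gt0; apply/set0Pn; exists b0.
  by rewrite !inE -leNgt -/b; lra.
rewrite -(ler_pM2l light_gt0).
apply: (@le_trans _ _ (\sum_(l in ~: hosts) load_weight l A)).
  apply: (@le_trans _ _ (\sum_(l in ~: hosts) a)); last first.
    by apply: ler_sum => l _; apply: min_a0.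
  by rewrite sumr_const -[leRHS]mulr_natl ler_wpM2r ?load_weight_ge0 ?ler_nat.
apply: (@le_trans _ _ (\sum_(l in ~: heavy) load_weight l B)); last first.
  rewrite [leRHS]mulr_natl -sumr_const; apply: ler_sum => l.
  by rewrite !inE -leNgt.
(* Compare task by task: a heavy task counts on neither side, and any other task counts fully on the
   right. *)
rewrite !sum_load_weight big_mkcond [leRHS]big_mkcond.
apply: ler_sum => i _; rewrite !in_setC.
case: (boolP (B i \in heavy)) => [heavy_i | _].
  by rewrite imset_f // inE.
by case: ifP => _ //; apply/ltW/weight_gt0.
Qed.

Lemma nash_sum_load_weight_le3 A B : nash A -> nash B ->
  \sum_i load_weight (A i) A <= 3 * \sum_i load_weight (B i) B.
Proof.
move=> nashA nashB.
have [a0 min_a0] := exists_least_load A.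
have [b0 min_b0] := exists_least_load B.
have le_ab := nash_least_load_le2 A B a0 b0 nashB min_a0.
rewrite mulr_sumr.
apply: (@le_trans _ _ (\sum_i (load_weight a0 A + weight i))).
  by apply: ler_sum => i _; apply: nash_load_weight.
(* With [a], [b] the loads of [a0], [b0], each term satisfies [a + weight i <= 2 b + weight i], and
   both [b] and [weight i] are at most the load of [B i]. *)
apply: ler_sum => i _.
have := weight_le_load_weight i B; have := min_b0 (B i).
lra.
Qed.

Lemma nash_social_cost_le3 A B : nash A -> nash B ->
  social_cost A <= 3 * social_cost B.
Proof.
move=> nashA nashB.
pose l0 := Ordinal (nres_gt0 I).
have costE D : social_cost D = delay l0 * \sum_i load_weight (D i) D.
  rewrite mulr_sumr; apply: eq_bigr => i _.
  by rewrite /load (identI (D i) l0).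
rewrite !costE mulrCA ler_pM2l ?delay_gt0 //.
exact: nash_sum_load_weight_le3.
Qed.

End NashLoads.

Theorem theorem3p3 (R : realType) (I : instance R)
    (hI : identical_resources I) :
  max_nash_cost I <= 3 * min_nash_cost I.
Proof.
have [[A nashA ->] _] := max_nash_costP I.
have [[B nashB ->] _] := min_nash_costP I.
exact: nash_social_cost_le3.
Qed.
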